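(* Let $C\neq\{1\}$ be a cycle of $\mathfrak{R}$, and let $m_1,\dots,m_\ell$ denote the (distinct) odd elements of $C$, indexed cyclically so that $T(m_i)=m_{i+1}$ for each $i$, where the indices are read modulo $\ell$. Put $v_i := v_2(\sigma(m_i))$, let $V := v_1+\cdots+v_\ell$, and let $I(n) := \sigma(n)/n$. Then $\ell\ge 1$, and the following statements hold. (a) $\prod_{i=1}^{\ell} I(m_i) = 2^V$. (b) $\ell=1$ if and only if $m_1$ is an odd $2^{v_1}$-perfect number. The case $v_1=1$ is precisely that of an odd perfect number. (c) The smallest of the integers $m_1,\dots,m_\ell$ is not squarefree. (d) If none of $m_1,\dots,m_\ell$ is a perfect square, then $I(m_i)\ge 2$ for at least one index $i$.
   Context: $\sigma(n)=\sum_{d\mid n} d$ is the sum-of-divisors function and $v_2(m)$ is the exponent of $2$ in $m$. The map $\mathfrak{R}$ on positive integers is defined by $\mathfrak{R}(n)=\sigma(n)$ if $n$ is odd and $\mathfrak{R}(n)=n/2$ if $n$ is even; $\mathfrak{R}^k$ denotes its $k$-th iterate. For odd $n$, $T(n) := \sigma(n)/2^{v_2(\sigma(n))}$ is the odd part of $\sigma(n)$; the odd elements of a cycle of $\mathfrak{R}$ are permuted cyclically by $T$. A cycle of $\mathfrak{R}$ is the orbit $\{n,\mathfrak{R}(n),\mathfrak{R}^2(n),\dots\}$ of a positive integer $n$ for which $\mathfrak{R}^k(n)=n$ for some $k\ge 1$. A positive integer $N$ is an odd $2^k$-perfect number ($k\ge 1$) if $N$ is odd and $\sigma(N)=2^kN$;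 it is an odd perfect number if $N$ is odd and $\sigma(N)=2N$. *)

(* Defs.v *)
From mathcomp Require Import all_boot all_order all_algebra.
From mathcomp Require Import boolp classical_sets.

Set Implicit Arguments.
Unset Strict Implicit.
Unset Printing Implicit Defensive.

Import Order.TTheory GRing.Theory Num.Theory.

Definition sigma (n : nat) : nat := \sum_(d <- divisors n) d.

Definition v2 (n : nat) : nat := logn 2 n.

Definition frakR (n : nat) : nat := if odd n then sigma n else n./2.

Definition T (n : nat) : nat := sigma n %/ 2 ^ v2 (sigma n).

Definition abundancy (n : nat) : rat := ((sigma n)%:R / n%:R)%R.

(* 0 is a fixed point of [frakR] on [nat]; since [frakR] preserves positivity,
   requiring [0 < n] makes [C] a set of positive integers. *)
Definition is_cycle (C : set nat) : Prop :=
  exists n : nat,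
    [/\ 0 < n,
        exists2 k : nat, 1 <= k & iter k frakR n = n
      & C = range (fun j : nat => iter j frakR n)].

(* The indices of the family are 0, ..., l - 1 instead of 1, ..., l;
   [ordS i] is i + 1 read modulo l. *)
Definition cyclic_indexing (C : set nat) (l : nat) (m : 'I_l -> nat) : Prop :=
  [/\ injective m,
      forall x : nat, (odd x /\ C x) <-> exists i : 'I_l, x = m i
    & forall i : 'I_l, T (m i) = m (ordS i)].

Definition odd_2k_perfect (k N : nat) : Prop :=
  [/\ 1 <= k, odd N & sigma N = 2 ^ k * N].

Definition odd_perfect (N : nat) : Prop := odd N /\ sigma N = 2 * N.

Definition squarefree (n : nat) : Prop :=
  forall d : nat, d ^ 2 %| n -> d = 1.

Definition perfect_square (n : nat) : Prop := exists d : nat, n = d ^ 2.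

Lemma sigma_gt0 n : 0 < n -> 0 < sigma n.
Proof.
move=> n0; rewrite /sigma (big_rem n) /=; last by rewrite -dvdn_divisors.
by rewrite addn_gt0 n0.
Qed.

Lemma odd_T n : 0 < n -> odd (T n).
Proof.
move=> /sigma_gt0 s0; rewrite /T /v2.
have [q] := pfactor_coprime (isT : prime 2) s0.
by rewrite coprime2n => oq {1}->; rewrite mulnK ?expn_gt0.
Qed.

Lemma iter_half_frakR q t j :
  t <= j -> iter t frakR (2 ^ j * q) = 2 ^ (j - t) * q.
Proof.
elim: t => [|t IH] tj; first by rewrite subn0.
rewrite iterS IH ?(ltnW tj) // subnS.
have : 0 < j - t by rewrite subn_gt0.
case: (j - t) => // d _.
by rewrite /frakR expnS -mulnA mul2n odd_double doubleK.
Qed.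

Lemma sigmaE n : sigma n = 2 ^ v2 (sigma n) * T n.
Proof. by rewrite mulnC /T divnK // pfactor_dvdnn. Qed.

Lemma iter_frakR_T n : odd n -> iter (v2 (sigma n)).+1 frakR n = T n.
Proof.
move=> on; rewrite iterSr /frakR on -/frakR {2}sigmaE.
by rewrite iter_half_frakR // subnn mul1n.
Qed.

Lemma odd_iter_frakR j x : 0 < j -> odd x -> odd (iter j frakR x) ->
  exists2 i, 0 < i & iter j frakR x = iter i T x.
Proof.
elim/ltn_ind: j x => j IH x j0 ox oj.
have [jv|vj] := leqP j (v2 (sigma x)).
  move: oj; case: j j0 jv {IH} => // j _ jv.
  rewrite iterSr {2}/frakR ox sigmaE iter_half_frakR ?(ltnW jv) //.
  by rewrite oddM oddX subn_eq0 leqNgt jv.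
move: oj; rewrite -(subnK vj) iterD iter_frakR_T // => oj.
have [e|n0] := posnP (j - (v2 (sigma x)).+1).
  by exists 1 => //; rewrite e.
have [||i i0 e] := IH _ _ (T x) n0 _ oj.
- by rewrite ltn_subrL.
- by rewrite odd_T // odd_gt0.
- by exists i.+1 => //; rewrite e -iterSr.
Qed.

Lemma iter_T_frakR i x : odd x -> exists j, iter i T x = iter j frakR x.
Proof.
elim: i x => [|i IH] x ox; first by exists 0.
have [|j e] := IH (T x); first by rewrite odd_T // odd_gt0.
by exists (j + (v2 (sigma x)).+1); rewrite iterSr e iterD iter_frakR_T.
Qed.

Lemma odd_iter_T i x : odd x -> odd (iter i T x).
Proof. by move=> ox; elim: i => //= i IH; rewrite odd_T // odd_gt0. Qed.

(* Hence quantifying over all cyclic indexings of a cycle is never vacuous. *)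
Lemma cyclic_indexing_exists (C : set nat) :
  is_cycle C -> exists (l : nat) (m : 'I_l -> nat), cyclic_indexing C m.
Proof.
case=> n [n0 [k k1 kn] ->].
have [[a oa]|no] := pselect (exists a, odd (iter a frakR n)); last first.
  exists 0, (fun=> 0); split=> [[]//|x|[]//]; split=> [[ox [j _ e]]|[[]//]].
  by case: no; exists j; rewrite e.
set x := iter a frakR n in oa.
have kx : iter k frakR x = x by rewrite /x -iterD addnC iterD kn.
have nx : exists b, n = iter b frakR x.
  have kj j : iter (j * k) frakR n = n.
    by elim: j => //= j IH; rewrite mulSn iterD IH.
  exists (a * k - a); rewrite /x -iterD subnK ?kj //.
  by rewrite -{1}(muln1 a) leq_mul2l k1 orbT.
have per : exists p, (0 < p) && (iter p T x == x).
  have [|i i0 e] := @odd_iter_frakR k x k1 oa; first by rewrite kx.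
  by exists i; rewrite i0 -e kx eqxx.
case: (ex_minnP per) => p /andP[p0 /eqP px] pmin.
have modp i : iter (i %% p) T x = iter i T x.
  have kj j : iter (j * p) T x = x.
    by elim: j => //= j IH; rewrite mulSn iterD IH.
  by rewrite {2}(divn_eq i p) addnC iterD kj.
have ninj (i j : nat) : i < j -> j < p -> iter i T x <> iter j T x.
  move=> ij jp e.
  have /pmin : (0 < p - j + i) && (iter (p - j + i) T x == x).
    by rewrite addn_gt0 subn_gt0 jp iterD e -iterD subnK ?(ltnW jp) // px eqxx.
  by rewrite leqNgt -ltn_subRL subKn ?(ltnW jp) // ij.
exists p, (fun i : 'I_p => iter i T x); split.
- move=> i j e; apply: val_inj => /=.
  by case: (ltngtP i j) => // [/ninj|/ninj] /(_ (ltn_ord _)); rewrite e.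
- move=> y; split=> [[oy [j _ e]]|[i ->]].
    have [b nb] := nx.
    have ey : y = iter (j + b + k) frakR x by rewrite iterD kx iterD -nb.
    have [||i _ ei] := @odd_iter_frakR (j + b + k) x _ oa.
    - by rewrite addn_gt0 k1 orbT.
    - by rewrite -ey.
    by exists (Ordinal (ltn_pmod i p0)); rewrite /= modp -ei.
  split; first exact: odd_iter_T.
  have [j ->] := iter_T_frakR i oa.
  by exists (j + a) => //; rewrite iterD.
- by move=> i; rewrite /= modp.
Qed.

(* Main.v *)
Require Import Defs.
From mathcomp Require Import all_boot all_order all_algebra.
From mathcomp Require Import boolp classical_sets.

Set Implicit Arguments.
Unset Strict Implicit.

Import Order.TTheory GRing.Theory Num.Theory.

(* Since [sigma (m i) = 2 ^ v i * m (i + 1)], the product of the abundancies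
   telescopes to 2 ^ V.  For a squarefree odd n > 1, [T n] is the product over
   the primes p dividing n of the odd part of p + 1, which is at most
   (p + 1) / 2 < p; so [T n < n], and n is not the smallest odd element of a
   cycle.  For an odd nonsquare n the divisors pair off as {d, n / d}, so
   [sigma n] is even; if all [m i] are such, then V >= l, and the abundancies
   cannot all be below 2. *)

Lemma sigma_gt_id n : 1 < n -> n < sigma n.
Proof.
move=> n1; have n0 : 0 < n by apply: ltnW.
rewrite /sigma (big_rem n) /=; last by rewrite -dvdn_divisors.
rewrite (big_rem 1) /=; last first.
  rewrite mem_rem_uniq ?divisors_uniq // inE -dvdn_divisors // dvd1n andbT.
  by rewrite neq_ltn n1.
by rewrite addnA addn1 leq_addr.
Qed.

(** The divisors of [p * n] are those of [n] and their multiples by [p]; the two families are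
    disjoint because [p] does not divide [n]. *)
Lemma sigma_primeM p n : prime p -> 0 < n -> ~~ (p %| n) ->
  sigma (p * n) = p.+1 * sigma n.
Proof.
move=> pp n0 pn; have p0 := prime_gt0 pp.
have pn0 : 0 < p * n by rewrite muln_gt0 p0.
rewrite /sigma (perm_big (divisors n ++ [seq p * d | d <- divisors n])).
  by rewrite big_cat big_map -big_distrr /= mulSn.
apply: uniq_perm; first exact: divisors_uniq.
  rewrite cat_uniq divisors_uniq map_inj_uniq ?divisors_uniq; last first.
    by move=> a b /eqP; rewrite eqn_pmul2l // => /eqP.
  rewrite andbT; apply/hasPn => _ /mapP[d _ ->].
  rewrite -dvdn_divisors //; apply: contra pn; apply: dvdn_trans.
  exact: dvdn_mulr.
move=> d; rewrite mem_cat -!dvdn_divisors //; apply/idP/orP => [dpn|[dn|]].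
- have [/dvdnP[e de]|npd] := boolP (p %| d); [right|left].
    rewrite de mulnC map_f // -dvdn_divisors // -(dvdn_pmul2l p0).
    by rewrite mulnC -de.
  by rewrite -(Gauss_dvdr _ (_ : coprime d p)) // coprime_sym prime_coprime.
- exact: dvdn_mull.
- by case/mapP=> e; rewrite -dvdn_divisors // => en ->; rewrite dvdn_pmul2l.
Qed.

Lemma T_mul a b : 0 < a -> 0 < b -> sigma (a * b) = sigma a * sigma b ->
  T (a * b) = T a * T b.
Proof.
move=> a0 b0 e; rewrite {1}/T e /v2 lognM ?sigma_gt0 // {1}(sigmaE a).
by rewrite {1}(sigmaE b) mulnACA -expnD mulKn // expn_gt0.
Qed.

Lemma sigma1 : sigma 1 = 1.
Proof. by rewrite /sigma big_seq1. Qed.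

Lemma sigma_prime p : prime p -> sigma p = p.+1.
Proof.
move=> pp; rewrite -{1}(muln1 p) sigma_primeM // ?sigma1 ?muln1 //.
by rewrite gtnNdvd // prime_gt1.
Qed.

Lemma v2_sigma_gt0 n : 0 < n -> ~~ odd (sigma n) -> 0 < v2 (sigma n).
Proof. by move=> n0 e; rewrite logn_gt0 mem_primes sigma_gt0 // dvdn2. Qed.

Lemma double_T_le n : 0 < n -> ~~ odd (sigma n) -> 2 * T n <= sigma n.
Proof.
move=> n0 even_s; rewrite [leqRHS]sigmaE leq_mul2r; apply/orP; right.
have := v2_sigma_gt0 n0 even_s.
by case: (v2 _) => // v _; rewrite expnS leq_pmulr // expn_gt0.
Qed.

Lemma T_prime_lt p : prime p -> odd p -> T p < p.
Proof.
move=> pp op; have := double_T_le (prime_gt0 pp).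
rewrite sigma_prime //= op => /(_ isT) le2.
rewrite -(ltn_pmul2l (isT : 0 < 2)); apply: leq_ltn_trans le2 _.
by rewrite mul2n -addnn -addn1 ltn_add2l prime_gt1.
Qed.

Lemma T_squarefree_lt n : 1 < n -> odd n -> squarefree n -> T n < n.
Proof.
elim/ltn_ind: n => n IH n1 on sf.
have pp := pdiv_prime n1; set p := pdiv n in pp *.
have p1 := prime_gt1 pp; have p0 := prime_gt0 pp.
have /dvdnP[q] := pdiv_dvd n; rewrite -/p mulnC => nE.
move: on; rewrite nE oddM => /andP[op oq]; have q0 := odd_gt0 oq.
have npq : ~~ (p %| q).
  apply/negP => /dvdnP[r qE]; have /sf pE : p ^ 2 %| n.
    by rewrite nE qE mulnC -mulnA dvdn_mull.
  by rewrite pE in p1.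
rewrite T_mul ?sigma_primeM ?(sigma_prime pp) //.
have Tp := T_prime_lt pp op.
(* The induction hypothesis only covers [1 < q]; for [q = 1] the factor [T q] is 1 and [T p < p]
   suffices. *)
have [q1|q1] := leqP q 1.
  have -> : q = 1 by apply/eqP; rewrite eqn_leq q1.
  by rewrite {2}/T sigma1 /v2 logn1 !muln1.
apply: ltn_mul => //; apply: IH => //.
  by rewrite nE ltn_Pmull.
by move=> d dq; apply: sf; rewrite nE dvdn_mull.
Qed.

Lemma sigma_even_nonsquare n : odd n -> ~ perfect_square n -> ~~ odd (sigma n).
Proof.
move=> on nsq; have n0 := odd_gt0 on.
have divE d : d \in divisors n -> d * (n %/ d) = n.
  by rewrite -dvdn_divisors // mulnC => /divnK.
have div_gt0 d : d \in divisors n -> 0 < d.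
  by rewrite -dvdn_divisors // => /dvdn_gt0 ->.
have codiv : perm_eq (divisors n) [seq n %/ d | d <- divisors n].
  have inv d : d \in divisors n -> n %/ (n %/ d) = d.
    move=> dn; have d0 := div_gt0 d dn; rewrite -{1}(divE d dn) mulnK //.
    by case: (n %/ d) (divE d dn) => //; rewrite muln0 => e; rewrite -e in n0.
  have cod d : d \in divisors n -> n %/ d \in divisors n.
    by move=> dn; rewrite -dvdn_divisors // -{2}(divE d dn) dvdn_mull.
  apply: uniq_perm; first exact: divisors_uniq.
    rewrite map_inj_in_uniq ?divisors_uniq // => a b an bn e.
    by rewrite -(inv a) // e inv.
  move=> d; apply/idP/mapP => [dn|[e en ->]]; last exact: cod.
  by exists (n %/ d); rewrite ?inv ?cod.
(* Split the divisors at the square root of [n], then reindex the upper half by the involution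
   [d -> n %/ d], so that both halves run over the small divisors. *)
rewrite /sigma (bigID (fun d => d * d < n)) /=.
rewrite [X in _ + X](perm_big _ codiv) /= big_map.
have -> : \sum_(d <- divisors n | ~~ (n %/ d * (n %/ d) < n)) n %/ d
        = \sum_(d <- divisors n | d * d < n) n %/ d.
  rewrite big_seq_cond [RHS]big_seq_cond; apply: eq_bigl => d.
  have [dn|//] := boolP (d \in divisors n) => /=.
  have e := divE d dn; have d0 := div_gt0 d dn.
  have q0 : 0 < n %/ d by case: (n %/ d) e n0 => // <-; rewrite muln0.
  (* With [n = d * q], the two conditions become [d <= q] and [d < q]; they differ only at [d = q],
     which would make [n] a square. *)
  move: (n %/ d) e q0 => q e q0; rewrite -e ltn_pmul2r // ltn_pmul2l // -leqNgt leq_eqVlt.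
  by case: eqP => // dq; case: nsq; exists d; rewrite -e -dq mulnn.
rewrite -big_split /= big_seq_cond.
apply: (big_ind (fun x => ~~ odd x)) => // [x y ex ey|d /andP[dn _]].
  by rewrite oddD (negbTE ex).
by move: on; rewrite -{1}(divE d dn) oddM oddD => /andP[-> ->].
Qed.

(** If every iterate were even, each step would halve, so returning after [k] steps would give
    [2 ^ k * n = n] with [k] and [n] positive. *)
Lemma cycle_has_odd C : is_cycle C -> exists2 x, odd x & C x.
Proof.
case=> n [n0 [k k1 kn] ->].
have [[a oa]|no] := pselect (exists a, odd (iter a frakR n)).
  by exists (iter a frakR n) => //; exists a.
have halve j : 2 ^ j * iter j frakR n = n.
  elim: j => [|j IH]; first by rewrite mul1n.
  have /negP/negbTE ej : ~ odd (iter j frakR n) by move=> oj; apply: no; exists j.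
  rewrite expnSr -mulnA iterS {1}/frakR ej mul2n even_halfK ?ej //.
have := halve k; rewrite kn => /eqP.
rewrite -[X in _ == X]mul1n eqn_pmul2r // => /eqP e.
by have := ltn_expl k (isT : 1 < 2); rewrite e ltnNge k1.
Qed.

Lemma cycle_of_one C : is_cycle C -> C 1 -> C = [set 1]%classic.
Proof.
case=> n [n0 [k k1 kn] ->] [j _ j1].
have fix1 t : iter t frakR 1 = 1.
  by elim: t => //= t ->; rewrite /frakR /= sigma1.
have kj i : iter (i * k) frakR n = n.
  by elim: i => //= i IH; rewrite mulSn iterD IH.
(* The orbit sits at 1 from time [j] on, and is back at [n] at the later time [j * k]. *)
have n1 : n = 1.
  rewrite -(kj j) -(subnK (_ : j <= j * k)) ?iterD ?j1 ?fix1 //.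
  exact: leq_pmulr.
apply/seteqP; split=> [_ [i _ <-]|_ ->]; first by rewrite n1 fix1.
by exists j.
Qed.

Lemma T_of_sigma k n : odd n -> sigma n = 2 ^ k * n ->
  v2 (sigma n) = k /\ T n = n.
Proof.
move=> on e; have n0 := odd_gt0 on.
have vk : v2 (sigma n) = k.
  rewrite /v2 e lognM ?expn_gt0 // pfactorK // -[RHS]addn0; congr (_ + _).
  by rewrite lognE dvdn2 on /= andbF.
by split=> //; rewrite /T vk e mulKn // expn_gt0.
Qed.

Lemma abundancyE n :
  (abundancy n = 2%:R ^+ v2 (sigma n) * ((T n)%:R / n%:R))%R.
Proof. by rewrite /abundancy {1}sigmaE natrM natrX mulrA. Qed.

Theorem theorem2p8 (C : set nat) (hC : is_cycle C) (hC1 : C <> [set 1]%classic)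
    (l : nat) (m : 'I_l -> nat) (hm : cyclic_indexing C m) :
  let v := fun i : 'I_l => v2 (sigma (m i)) in
  let V := \sum_(i < l) v i in
  1 <= l /\
  (* (a) *)
  (\prod_(i < l) abundancy (m i) = 2%:R ^+ V)%R /\
  (* (b) *)
  (forall i1 : 'I_l, i1 = 0 :> nat ->
     (l = 1 <-> odd_2k_perfect (v i1) (m i1)) /\
     (l = 1 /\ v i1 = 1 <-> odd_perfect (m i1))) /\
  (* (c) *)
  (forall i : 'I_l, (forall j : 'I_l, m i <= m j) -> ~ squarefree (m i)) /\
  (* (d) *)
  ((forall i : 'I_l, ~ perfect_square (m i)) ->
     exists i : 'I_l, (2%:R <= abundancy (m i))%R).
Proof.
move=> v V; case: hm => minj mC mT.
have mP i : odd (m i) /\ C (m i) by apply/mC; exists i.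
have om i : odd (m i) := (mP i).1.
have m0 i : 0 < m i := odd_gt0 (om i).
(* Here [C <> {1}] enters: a cycle through 1 is trivial. *)
have m1 i : 1 < m i.
  rewrite ltn_neqAle m0 andbT eq_sym; apply/eqP => e; apply: hC1.
  by apply: cycle_of_one => //; rewrite -e; case: (mP i).
have l1 : 0 < l.
  have [x ox Cx] := cycle_has_odd hC.
  have [|i _] := (mC x).1; first by split.
  exact: leq_ltn_trans (ltn_ord i).
have prodE : (\prod_(i < l) abundancy (m i) = 2%:R ^+ V :> rat)%R.
  under eq_bigr => i _ do rewrite abundancyE mT.
  rewrite big_split /= prodrXr prodf_div.
  (* Shifting the index cyclically in the denominators matches them with the numerators
     [m (ordS i)]. *)
  rewrite [X in (_ / X)%R](reindex (@ordS l)) /=; last exact/onW_bij/ordS_bij.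
  rewrite divff ?mulr1 //; apply/prodf_neq0 => i _.
  by rewrite pnatr_eq0 -lt0n.
have fixP i : l = 1 <-> T (m i) = m i.
  rewrite mT; split=> [l_eq1|/minj /(congr1 val) /= e].
    have ord_eq0 (j : 'I_l) : j = 0 :> nat.
      by have := ltn_ord j; rewrite [X in _ < X]l_eq1; case: (nat_of_ord j).
    by have -> : ordS i = i by apply: ord_inj; rewrite !ord_eq0.
  (* If [i] is the last index, its successor wraps around to 0, so [i = 0] and [l = 1]; otherwise
     [i + 1 = i] is absurd. *)
  have := ltn_ord i; rewrite leq_eqVlt => /orP[/eqP il|il].
    by move: e; rewrite il modnn => i0; rewrite -il -i0.
  by move: e; rewrite modn_small // => /eqP; rewrite eqn_leq ltnn.
(* This gives the exponent bound in [odd_2k_perfect]: [v i = 0] would mean [sigma (m i) = m i],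
   impossible above 1. *)
have v_gt0 i : T (m i) = m i -> 0 < v i.
  move=> Tm; rewrite lt0n; apply/eqP => v0.
  by have := sigma_gt_id (m1 i); rewrite sigmaE -/(v i) v0 Tm mul1n ltnn.
do 2!split=> //; split; [|split].
- move=> i1 _; split; rewrite (fixP i1); split.
  + by move=> Tm; split=> //; [exact: v_gt0|rewrite {1}sigmaE Tm].
  + by case=> _ _ /(T_of_sigma (om i1))[].
  + by case=> Tm v1; split=> //; rewrite sigmaE -/(v i1) v1 Tm.
  + by case=> _ /(@T_of_sigma 1 _ (om i1))[].
- move=> i mmin sf; have := T_squarefree_lt (m1 i) (om i) sf.
  by rewrite mT ltnNge mmin.
- move=> nsq; have [//|no] := pselect (exists i, (2%:R <= abundancy (m i))%R).
  have lV : l <= V.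
    rewrite -[l in l <= _]card_ord -sum1_card; apply: leq_sum => i _.
    by apply: v2_sigma_gt0 => //; apply: sigma_even_nonsquare.
  have : (\prod_(i < l) abundancy (m i) < \prod_(i < l) 2%:R)%R.
    apply: ltr_prod.
      (* Strictness of the product inequality requires a nonempty index set. *)
      by apply/hasP; exists (Ordinal l1); rewrite ?mem_index_enum.
    move=> i _; rewrite divr_ge0 ?ler0n //= ltNge; apply/negP => ge2.
    by apply: no; exists i.
  by rewrite prodE prodr_const card_ord ltNge ler_weXn2l // ler1n.
Qed.
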